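(* Let $\mathcal{C}$ be an idempotent Mal'cev clone on $\{0,1,2\}$ such that $\mathcal{C}$ contains no majority operation and does not preserve $\varphi=\{(0,1),(1,2),(2,0)\}$. Then $\mathcal{C}\equiv_{\mathrm{m}}\mathcal{Z}_2$.
   Context: A clone is idempotent if $f(x,\dots,x)\approx x$ for all its operations; Mal'cev if it contains $d$ with $d(y,x,x)\approx d(x,x,y)\approx y$; a majority operation $m$ satisfies $m(x,y,y)\approx m(y,x,y)\approx m(y,y,x)\approx y$. $\mathcal{Z}_2=\mathrm{Pol}(\{0,1\};\{(x,y,z,x-y+z\bmod 2)\},\{0\},\{1\})$ is the clone of idempotent affine operations modulo 2, where $\mathrm{Pol}(\Gamma)$ denotes the clone of operations preserving all relations of $\Gamma$. For an $n$-ary $f$ and $\sigma\colon[n]\to[r]$, $f_\sigma(x_1,\dots,x_r)=f(x_{\sigma(1)},\dots,x_{\sigma(n)})$; a minion homomorphism is an arity-preserving map $\xi$ between clones with $\xi(f_\sigma)=\xi(f)_\sigma$; $\mathcal{C}\equiv_{\mathrm{m}}\mathcal{D}$ means there are minion homomorphisms in both directions. *)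

(* Defs.v *)
From mathcomp Require Import all_boot.
Set Implicit Arguments. Unset Strict Implicit. Unset Printing Implicit Defensive.

Definition op (A : finType) (n : nat) := {ffun {ffun 'I_n -> A} -> A}.

Definition opfam (A : finType) := forall n : nat, op A n -> Prop.

Definition proj (A : finType) (n : nat) (i : 'I_n) : op A n := [ffun x : {ffun 'I_n -> A} => x i].

Definition comp (A : finType) (n m : nat) (f : op A n) (g : 'I_n -> op A m) : op A m :=
  [ffun x : {ffun 'I_m -> A} => f [ffun i => g i x]].

Definition is_clone (A : finType) (C : opfam A) : Prop :=
  (forall n (i : 'I_n), C n (proj A i)) /\
  (forall n m (f : op A n) (g : 'I_n -> op A m),
      C n f -> (forall i, C m (g i)) -> C m (comp f g)).

Definition minor (A : finType) (n r : nat) (sigma : 'I_n -> 'I_r) (f : op A n) : op A r :=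
  [ffun x : {ffun 'I_r -> A} => f [ffun i => x (sigma i)]].

Definition tri (A : finType) (x y z : A) : {ffun 'I_3 -> A} :=
  [ffun i : 'I_3 => if val i == 0 then x else if val i == 1 then y else z].

Definition idempotent_clone (A : finType) (C : opfam A) : Prop :=
  forall n (f : op A n), C n f -> forall x : A, f [ffun _ => x] = x.

Definition malcev (A : finType) (C : opfam A) : Prop :=
  exists d : op A 3, C 3 d /\
    forall x y : A, d (tri y x x) = y /\ d (tri x x y) = y.

Definition is_majority (A : finType) (m : op A 3) : Prop :=
  forall x y : A, m (tri x y y) = y /\ m (tri y x y) = y /\ m (tri y y x) = y.

Definition has_majority (A : finType) (C : opfam A) : Prop :=
  exists m : op A 3, C 3 m /\ is_majority m.

Definition rel_on (A : finType) (k : nat) := pred {ffun 'I_k -> A}.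

Definition preserves (A : finType) (n k : nat) (f : op A n) (R : rel_on A k) : Prop :=
  forall rows : 'I_n -> {ffun 'I_k -> A},
    (forall i, R (rows i)) -> R [ffun j => f [ffun i => rows i j]].

Definition clone_preserves (A : finType) (k : nat) (C : opfam A) (R : rel_on A k) : Prop :=
  forall n (f : op A n), C n f -> preserves f R.

Definition phi : rel_on 'I_3 2 :=
  fun t => let a := val (t ord0) in let b := val (t (lift ord0 ord0)) in
           ((a == 0) && (b == 1)) || ((a == 1) && (b == 2)) || ((a == 2) && (b == 0)).

Definition affine_rel : rel_on 'I_2 4 :=
  fun t => val (t (inord 3)) == (val (t (inord 0)) + val (t (inord 1)) + val (t (inord 2))) %% 2.
Definition const_rel (c : nat) : rel_on 'I_2 1 := fun t => val (t ord0) == c.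

(* Z_2 = Pol({0,1}; {(x,y,z,x-y+z mod 2)}, {0}, {1}) *)
Definition Z2 : opfam 'I_2 := fun n f =>
  preserves f affine_rel /\ preserves f (const_rel 0) /\ preserves f (const_rel 1).

Definition minion_hom (A B : finType) (C : opfam A) (D : opfam B)
    (xi : forall n, op A n -> op B n) : Prop :=
  (forall n (f : op A n), C n f -> D n (xi n f)) /\
  (forall n r (sigma : 'I_n -> 'I_r) (f : op A n),
      C n f -> xi r (minor sigma f) = minor sigma (xi n f)).

Definition minion_equiv (A B : finType) (C : opfam A) (D : opfam B) : Prop :=
  (exists xi, minion_hom C D xi) /\ (exists zeta, minion_hom D C zeta).

(* Main.v *)
Require Import Defs.
From mathcomp Require Import all_boot.
From Stdlib Require Import Classical_Prop.
Set Implicit Arguments. Unset Strict Implicit. Unset Printing Implicit Defensive.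

(* If C has no majority operation, a Baker-Pixley argument yields a ternary
   invariant relation S and tuples a, w such that w is not in S while each of
   (a1,w2,w3), (w1,a2,w3), (w1,w2,a3) is. The Mal'cev operation makes S, modulo
   congruences, a Latin square. A Latin square of order 3 would force C to
   preserve phi, so it has order 2: C acts affinely on a two-element quotient of
   a subalgebra, and this action is a minion homomorphism to Z_2.

   In the other direction, a minion homomorphism from Z_2 to an idempotent clone
   on {0,1,2} is determined by the value c = g(0,1,2) of the image g of x+y+z,
   which is the symmetric minority operation with g(0,1,2) = c. The affine
   section restricts the table of a Mal'cev operation enough that explicit terms
   produce a minority operation from it. As phi is not preserved, a minority
   operation can be chosen that does not preserve phi, and further terms turn it
   into some g. Finally g generates the images of all sums of odd length. *)

(** * Term operations on three letters, as tables *)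

Inductive elt := E0 | E1 | E2.

Definition eq_elt (x y : elt) :=
  match x, y with E0, E0 | E1, E1 | E2, E2 => true | _, _ => false end.

Lemma eq_eltP : Equality.axiom eq_elt.
Proof. by case; case; constructor. Qed.

Definition all_elt (p : elt -> bool) := [&& p E0, p E1 & p E2].

Lemma all_eltP (p : elt -> bool) : all_elt p -> forall x, p x.
Proof. by case/and3P => ? ? ?; case. Qed.

Definition succ_elt x := match x with E0 => E1 | E1 => E2 | E2 => E0 end.

Definition fun3 := elt -> elt -> elt -> elt.

(** Storing values instead of functions makes each step of a long composite cost 27 evaluations,
    whatever the size of the term reached. *)
Inductive triple (X : Type) := Triple of X & X & X.

Definition get X (t : triple X) (i : elt) :=
  let: Triple a b c := t in match i with E0 => a | E1 => b | E2 => c end.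

Definition tabulate X (f : elt -> X) := Triple (f E0) (f E1) (f E2).

Definition table := triple (triple (triple elt)).

Definition lookup (d : table) : fun3 := fun x y z => get (get (get d x) y) z.

Definition table_of (f : fun3) : table :=
  tabulate (fun x => tabulate (fun y => tabulate (f x y))).

Lemma lookup_table_of f x y z : lookup (table_of f) x y z = f x y z.
Proof. by case: x y z => [] [] []. Qed.

Inductive term := Vx | Vy | Vz | Op of term & term & term.

Fixpoint eval (d : table) (t : term) (x y z : elt) : elt :=
  match t with
  | Vx => x | Vy => y | Vz => z
  | Op t1 t2 t3 => lookup d (eval d t1 x y z) (eval d t2 x y z) (eval d t3 x y z)
  end.

Section Run.
Variables keep stop : table -> bool.

(** Candidates that lose [keep] are dropped and [stop] freezes the table, so that one word of terms
    serves many tables. Either way the result is a term in the initial operation. *)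
Definition step (d : table) (t : term) :=
  if stop d then d else
  let d' := table_of (eval d t) in if keep d' then d' else d.

Definition run := foldl step.

End Run.

(** * Mal'cev, minority and sum tables, with exhaustive checks *)

Definition is_malcev (d : table) :=
  all_elt (fun x => all_elt (fun y =>
    eq_elt (lookup d x y y) x && eq_elt (lookup d y y x) x)).

Definition is_minority (d : table) :=
  all_elt (fun x => all_elt (fun y =>
    [&& eq_elt (lookup d x y y) x, eq_elt (lookup d y x y) x &
        eq_elt (lookup d y y x) x])).

(* [bxy] is the value at (x,y,x) and [pxyz] the value at (x,y,z). *)
Definition malcev_table b01 b02 b10 b12 b20 b21 p012 p021 p102 p120 p201 p210 : table :=
  Triple (Triple (Triple E0 E1 E2) (Triple b01 E0 p012) (Triple b02 p021 E0))
         (Triple (Triple E1 b10 p102) (Triple E0 E1 E2) (Triple p120 b12 E1))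
         (Triple (Triple E2 p201 b20) (Triple p210 E2 b21) (Triple E0 E1 E2)).

(* This word and [sum_word] were found by computer search. The term [mu] already
   satisfies two of the three minority equations when [d] is Mal'cev. *)
Definition minority_word :=
  let mu := Op (Op Vx Vz Vy) (Op (Op Vx Vz Vy) (Op Vz Vy Vx) (Op Vy Vx Vz)) (Op Vy Vx Vz) in
  let t1 := Op (Op Vx Vy Vz) (Op Vy Vx Vy) (Op Vz Vx Vz) in
  let t2 := Op Vx (Op Vy Vx Vy) (Op Vy Vx Vz) in
  let t3 := Op (Op Vx Vz Vy) (Op Vy Vz Vy) Vz in
  [:: t3; t3; t2; t1; t2; t1; mu; t2; t3; t1; t3; mu; t2; t1; t2; mu].

Fixpoint nary_pred n : Type := if n is n'.+1 then elt -> nary_pred n' else bool.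

Fixpoint all_nary n : nary_pred n -> bool :=
  if n is n'.+1 then fun p => all_elt (fun x => all_nary (p x)) else id.

Fixpoint forall_nary n : nary_pred n -> Prop :=
  if n is n'.+1 then fun p => forall x, forall_nary (p x) else is_true.

Lemma all_naryP n (p : nary_pred n) : all_nary p -> forall_nary p.
Proof. by elim: n p => //= n IHn p /all_eltP h x; apply: IHn. Qed.

(** The case of the section {1,2}: the operation is affine there and the ten other entries are
    free. *)
Lemma sub_check : @forall_nary 10
  (fun b01 b02 b10 b20 p012 p021 p102 p120 p201 p210 => is_minority
    (run is_malcev is_minority
      (malcev_table b01 b02 b10 E2 b20 E1 p012 p021 p102 p120 p201 p210) minority_word)).
Proof. by apply: all_naryP; vm_compute. Qed.

(** The case of the classes {0} and {1,2}: entries falling in {0} are determined, the four others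
    need only avoid 0. *)
Lemma quo_check : @forall_nary 4
  (fun b01 b02 b12 b21 => ~~ has (eq_elt E0) [:: b01; b02; b12; b21] ==> is_minority
    (run is_malcev is_minority
      (malcev_table b01 b02 E0 b12 E0 b21 E0 E0 E0 E0 E0 E0) minority_word)).
Proof. by apply: all_naryP; vm_compute. Qed.

Definition gen_sum (c x y z : elt) : elt :=
  if eq_elt x y then z else if eq_elt x z then y else if eq_elt y z then x else c.

Definition is_sum (c : elt) (d : table) :=
  all_elt (fun x => all_elt (fun y => all_elt (fun z =>
    eq_elt (lookup d x y z) (gen_sum c x y z)))).

(** Compatibility with [phi], the graph of [succ_elt], on the orbit of (0,1,2). The third equation
    follows since [succ_elt] has order three. *)
Definition shift_on_cycle (p012 p120 p201 : elt) :=
  eq_elt p120 (succ_elt p012) && eq_elt p201 (succ_elt p120).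

Definition sum_word :=
  let r := Op Vy Vz Vx in let s := Op Vx Vz Vy in
  let a := Op (Op Vx Vy (Op Vx Vy Vz)) Vx Vy in
  let b := Op (Op Vx (Op Vx Vy Vz) Vy) Vx Vy in
  let e := Op (Op Vx Vy Vz) (Op Vz Vx Vy) (Op Vz Vy Vx) in
  [:: a; r; a; s; a; b; e; a; r; b; s; a].

Definition is_some_sum d := [|| is_sum E0 d, is_sum E1 d | is_sum E2 d].

Lemma sum_check : @forall_nary 6
  (fun p012 p021 p102 p120 p201 p210 => ~~ shift_on_cycle p012 p120 p201 ==>
   is_some_sum (run is_minority is_some_sum
      (malcev_table E1 E2 E0 E2 E0 E1 p012 p021 p102 p120 p201 p210) sum_word)).
Proof. by apply: all_naryP; vm_compute. Qed.

(** * Ternary members of a clone *)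

Definition i0 : 'I_3 := @Ordinal 3 0 isT.
Definition i1 : 'I_3 := @Ordinal 3 1 isT.
Definition i2 : 'I_3 := @Ordinal 3 2 isT.

Lemma ord3P (P : 'I_3 -> Prop) : P i0 -> P i1 -> P i2 -> forall i, P i.
Proof.
move=> P0 P1 P2 [[|[|[|m]]] lt_m3] //.
- by rewrite (_ : Ordinal _ = i0) //; apply: val_inj.
- by rewrite (_ : Ordinal _ = i1) //; apply: val_inj.
- by rewrite (_ : Ordinal _ = i2) //; apply: val_inj.
Qed.

Lemma prop_bool (P : 'I_3 -> Prop) : exists p : pred 'I_3, forall x, p x <-> P x.
Proof.
have decP x : exists b : bool, b <-> P x.
  by case: (classic (P x)) => Px; [exists true | exists false].
have [[b0 H0] [b1 H1] [b2 H2]] := And3 (decP i0) (decP i1) (decP i2).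
exists (fun x => if x == i0 then b0 else if x == i1 then b1 else b2).
exact: ord3P.
Qed.

Section Ternary.
Variables (A : finType) (C : opfam A).
Hypotheses (C_clone : is_clone C) (C_idem : idempotent_clone C).

Definition tern (t : A -> A -> A -> A) : op A 3 :=
  [ffun v : {ffun 'I_3 -> A} => t (v i0) (v i1) (v i2)].

Definition in_tern t := C (tern t).

Lemma triE (x y z : A) : (tri x y z i0 = x) * (tri x y z i1 = y) * (tri x y z i2 = z).
Proof. by rewrite !ffunE. Qed.

Lemma tern_tri t x y z : tern t (tri x y z) = t x y z.
Proof. by rewrite ffunE !triE. Qed.

Lemma tern_app (f : op A 3) : tern (fun x y z => f (tri x y z)) = f.
Proof.
apply/ffunP => v; rewrite ffunE; congr (f _); apply/ffunP.
by apply: ord3P; rewrite triE.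
Qed.

Lemma eq_tern t u : (forall x y z, t x y z = u x y z) -> tern t = tern u.
Proof. by move=> eq_tu; apply/ffunP => v; rewrite !ffunE. Qed.

Lemma in_tern_app (f : op A 3) : C f -> in_tern (fun x y z => f (tri x y z)).
Proof. by rewrite /in_tern tern_app. Qed.

Lemma in_tern_proj :
  [/\ in_tern (fun x _ _ => x), in_tern (fun _ y _ => y) & in_tern (fun _ _ z => z)].
Proof.
case: C_clone => Cproj _; split.
- by rewrite /in_tern (_ : tern _ = proj A i0) //; apply/ffunP => v; rewrite !ffunE.
- by rewrite /in_tern (_ : tern _ = proj A i1) //; apply/ffunP => v; rewrite !ffunE.
- by rewrite /in_tern (_ : tern _ = proj A i2) //; apply/ffunP => v; rewrite !ffunE.
Qed.

Lemma in_clone_comp3 n t (F1 F2 F3 : op A n) :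
  in_tern t -> C F1 -> C F2 -> C F3 -> C [ffun x => t (F1 x) (F2 x) (F3 x)].
Proof.
case: C_clone => _ Ccomp Ct C1 C2 C3.
pose F (i : 'I_3) := if i == i0 then F1 else if i == i1 then F2 else F3.
rewrite (_ : [ffun x => _] = Defs.comp (tern t) F).
  by apply: Ccomp => //; apply: ord3P.
by apply/ffunP => x; rewrite !ffunE.
Qed.

Lemma in_tern_comp t u1 u2 u3 :
  in_tern t -> in_tern u1 -> in_tern u2 -> in_tern u3 ->
  in_tern (fun x y z => t (u1 x y z) (u2 x y z) (u3 x y z)).
Proof.
move=> Ct C1 C2 C3; have := in_clone_comp3 Ct C1 C2 C3.
by congr (C _); apply/ffunP => v; rewrite !ffunE.
Qed.

Lemma in_clone_minor n r (sigma : 'I_n -> 'I_r) (f : op A n) : C f -> C (minor sigma f).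
Proof.
case: C_clone => Cproj Ccomp Cf.
rewrite (_ : minor _ _ = Defs.comp f (fun i => proj A (sigma i))); first exact: Ccomp.
by apply/ffunP => x; rewrite !ffunE; congr (f _); apply/ffunP => i; rewrite !ffunE.
Qed.

Lemma in_tern_idem t x : in_tern t -> t x x x = x.
Proof. by move/C_idem/(_ x); rewrite ffunE !ffunE. Qed.

(* Baker-Pixley: a majority operation can be assembled from operations that
   satisfy one instance of each of the three majority equations. *)
Section LocalMajority.
Hypothesis local_majority : forall a1 w1 a2 w2 a3 w3 : A, exists t, in_tern t /\
  [/\ t a1 w1 w1 = w1, t w2 a2 w2 = w2 & t w3 w3 a3 = w3].

(** The triple [(k, a, w)] encodes a majority equation: [a] at position [k], [w] elsewhere, expected
    value [w]. *)
Let dissent (p : 'I_3 * A * A) (t : A -> A -> A -> A) :=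
  let: (k, a, w) := p in
  t (if k == i0 then a else w) (if k == i1 then a else w) (if k == i2 then a else w).

(** Induction on the number of equations: [u1], [u2], [u3] each omit one of [p1], [p2], [p3], so
    each of these three is met by two of them, and [m] repairs the remaining one. *)
Let majority_on (L : seq ('I_3 * A * A)) :
  exists t, in_tern t /\ forall p, p \in L -> dissent p t = p.2.
Proof.
have [pX pY pZ] := in_tern_proj.
(* Two equations leave a position where neither dissents; the projection there meets both. *)
have pair k1 a1 w1 k2 a2 w2 : exists t, in_tern t /\
   dissent (k1, a1, w1) t = w1 /\ dissent (k2, a2, w2) t = w2.
  case: (boolP ((k1 != i0) && (k2 != i0))) => [/andP[/negPf n1 /negPf n2]|n0].
    by exists (fun x _ _ => x); split=> //=; rewrite n1 n2.
  case: (boolP ((k1 != i1) && (k2 != i1))) => [/andP[/negPf n1 /negPf n2]|n1].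
    by exists (fun _ y _ => y); split=> //=; rewrite n1 n2.
  exists (fun _ _ z => z); split=> //=.
  by move: n0 n1; elim/ord3P: k1; elim/ord3P: k2.
have [n] := ubnP (size L); elim: n L => // n IHn L.
case: L => [_|p1 [_|p2 [_|p3 L]]].
- by exists (fun x _ _ => x).
- case: p1 => [[k a] w]; have [t [Ct [t1 _]]] := pair k a w k a w.
  by exists t; split=> // p; rewrite inE => /eqP->.
- case: p1 p2 => [[k a] w] [[k' a'] w']; have [t [Ct [t1 t2]]] := pair k a w k' a' w'.
  by exists t; split=> // p; rewrite !inE => /orP[] /eqP->.
rewrite ltnS /= => ltLn.
have [u1 [C1 e1]] := IHn [:: p2, p3 & L] ltLn.
have [u2 [C2 e2]] := IHn [:: p1, p3 & L] ltLn.
have [u3 [C3 e3]] := IHn [:: p1, p2 & L] ltLn.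
have [m [Cm [m1 m2 m3]]] :=
  local_majority (dissent p1 u1) p1.2 (dissent p2 u2) p2.2 (dissent p3 u3) p3.2.
exists (fun x y z => m (u1 x y z) (u2 x y z) (u3 x y z)).
split=> [|p Lp]; first exact: in_tern_comp.
have -> : dissent p (fun x y z => m (u1 x y z) (u2 x y z) (u3 x y z)) =
    m (dissent p u1) (dissent p u2) (dissent p u3) by case: p Lp => [[]].
have [->|np1] := eqVneq p p1; first by rewrite e2 ?e3 ?inE ?eqxx // m1.
have [->|np2] := eqVneq p p2; first by rewrite e1 ?e3 ?inE ?eqxx ?orbT // m2.
have [->|np3] := eqVneq p p3; first by rewrite e1 ?e2 ?inE ?eqxx ?orbT // m3.
move: Lp; rewrite !inE (negPf np1) (negPf np2) (negPf np3) /= => Lp.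
rewrite e1 ?e2 ?e3 ?inE ?Lp ?orbT //.
exact: in_tern_idem.
Qed.

Lemma majority_of_local : has_majority C.
Proof.
have [t [Ct tP]] := majority_on (enum [set: 'I_3 * A * A]).
exists (tern t); split=> // x y; rewrite !tern_tri.
by split; [have := tP (i0, x, y) | split; [have := tP (i1, x, y) | have := tP (i2, x, y)]];
   rewrite mem_enum inE; apply.
Qed.

End LocalMajority.
End Ternary.

(** * The critical ternary relation and its congruence *)

Section Critical.
Variable C : opfam 'I_3.
Hypotheses (C_clone : is_clone C) (C_idem : idempotent_clone C).
Variable d : 'I_3 -> 'I_3 -> 'I_3 -> 'I_3.
Hypotheses (Cd : in_tern C d) (d_left : forall x y, d y x x = y)
  (d_right : forall x y, d x x y = y).
Variables a1 w1 a2 w2 a3 w3 : 'I_3.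
Hypothesis no_local_majority : ~ exists t, in_tern C t /\
  [/\ t a1 w1 w1 = w1, t w2 a2 w2 = w2 & t w3 w3 a3 = w3].

(** The invariant relation generated by the three tuples of [crit_gens]; the hypothesis says that
    [(w1, w2, w3)] lies outside. *)
Definition crit (x y z : 'I_3) := exists t, in_tern C t /\
  [/\ t a1 w1 w1 = x, t w2 a2 w2 = y & t w3 w3 a3 = z].

Lemma crit_gens : [/\ crit a1 w2 w3, crit w1 a2 w3 & crit w1 w2 a3].
Proof.
have [pX pY pZ] := in_tern_proj C_clone.
by split; [exists (fun x _ _ => x) | exists (fun _ y _ => y) | exists (fun _ _ z => z)].
Qed.

Lemma critN : ~ crit w1 w2 w3. Proof. exact: no_local_majority. Qed.

Lemma crit_closed n (f : op 'I_3 n) (U V W : 'I_n -> 'I_3) : C f ->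
  (forall i, crit (U i) (V i) (W i)) -> crit (f (finfun U)) (f (finfun V)) (f (finfun W)).
Proof.
move=> Cf /fin_all_exists[t tP].
exists (fun x y z => f [ffun i => t i x y z]); split; last first.
  by split; congr (f _); apply/ffunP => i; rewrite !ffunE; have [_ []] := tP i.
have [_ Ccomp] := C_clone.
rewrite /in_tern (_ : tern _ = Defs.comp f (fun i => tern (t i))).
  by apply: Ccomp => // i; have [] := tP i.
by apply/ffunP => v; rewrite !ffunE; congr (f _); apply/ffunP => i; rewrite !ffunE.
Qed.

Lemma crit_tern t x1 y1 z1 x2 y2 z2 x3 y3 z3 : in_tern C t ->
  crit x1 y1 z1 -> crit x2 y2 z2 -> crit x3 y3 z3 ->
  crit (t x1 x2 x3) (t y1 y2 y3) (t z1 z2 z3).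
Proof.
move=> Ct c1 c2 c3; rewrite -!(tern_tri t); apply: crit_closed => //.
by apply: ord3P.
Qed.

(** Rectangularity: [d] is applied to the second, first and third tuple. *)
Lemma crit_fork1 x x' y y' z z' :
  crit x y z -> crit x' y z -> crit x y' z' -> crit x' y' z'.
Proof.
by move=> c c' c''; have := crit_tern Cd c' c c''; rewrite d_left !d_right.
Qed.

Lemma crit_fork2 x x' y y' z z' :
  crit x y z -> crit x y' z -> crit x' y z' -> crit x' y' z'.
Proof.
by move=> c c' c''; have := crit_tern Cd c' c c''; rewrite d_left !d_right.
Qed.

Lemma crit_fork3 x x' y y' z z' :
  crit x y z -> crit x y z' -> crit x' y' z -> crit x' y' z'.
Proof.
by move=> c c' c''; have := crit_tern Cd c' c c''; rewrite d_left !d_right.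
Qed.

Definition dom x := exists y z, crit x y z.

(* The congruence modulo which the first coordinate of [crit] is a function of
   the other two. *)
Definition sim x x' := exists y z, crit x y z /\ crit x' y z.

Lemma sim_crit x x' y z : sim x x' -> crit x y z -> crit x' y z.
Proof. by case=> y' [z' [c c']]; apply: crit_fork1 c c'. Qed.

Lemma sim_refl x : dom x -> sim x x.
Proof. by case=> y [z c]; exists y, z. Qed.

Lemma sim_sym x x' : sim x x' -> sim x' x.
Proof. by case=> y [z [c c']]; exists y, z. Qed.

Lemma sim_trans x x' x'' : sim x x' -> sim x' x'' -> sim x x''.
Proof.
move=> s [y [z [c c']]]; exists y, z; split=> //.
exact: sim_crit (sim_sym s) c.
Qed.

Lemma dom_w3 x : dom x -> exists y, crit x y w3.
Proof.
have [g1 g2 g3] := crit_gens.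
(* [t] is applied to the first, second and again second generator, which share the third coordinate
   [w3]. *)
case=> _ [_ [t [Ct [<- _ _]]]]; exists (t w2 a2 a2).
by have := crit_tern Ct g1 g2 g2; rewrite (in_tern_idem C_idem w3 Ct).
Qed.

Lemma crit_a2_a3 : crit (d w1 a1 w1) a2 a3.
Proof.
have [g1 g2 g3] := crit_gens.
by have := crit_tern Cd g2 g1 g3; rewrite d_left d_right.
Qed.

Lemma crit_a3 x y z : crit x y z -> exists x', crit x' y a3.
Proof.
have [g1 g2 g3] := crit_gens.
(* The three tuples fed to [t] have second coordinates [w2], [a2], [w2], which yields [y], and
   common third coordinate [a3]. *)
case=> t [Ct [_ <- _]]; exists (t w1 (d w1 a1 w1) w1).
by have := crit_tern Ct g3 crit_a2_a3 g3; rewrite (in_tern_idem C_idem a3 Ct).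
Qed.

Lemma dom_gens : dom a1 /\ dom w1.
Proof. by have [g1 g2 g3] := crit_gens; split; [exists w2, w3 | exists a2, w3]. Qed.

Lemma sim_a1_w1 : ~ sim a1 w1.
Proof. by have [g1 _ _] := crit_gens; move=> /sim_crit/(_ g1); apply: critN. Qed.

(** Otherwise rectangularity would replace [a3] by [w3] in the third generator. *)
Lemma crit_a3_w3 x y : crit x y w3 -> crit x y a3 -> False.
Proof.
have [_ _ g3] := crit_gens; move=> c c'; apply: critN.
exact: crit_fork3 c' c g3.
Qed.

Lemma dom_closed n (f : op 'I_3 n) (U : 'I_n -> 'I_3) : C f ->
  (forall i, dom (U i)) -> dom (f (finfun U)).
Proof.
move=> Cf /fin_all_exists[V] /fin_all_exists[W] c.
by exists (f (finfun V)), (f (finfun W)); apply: crit_closed.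
Qed.

(** * Three classes: invariance of the 3-cycle *)

Section ThreeClasses.
Variable e : 'I_3.
Hypotheses (dom_e : dom e) (e_a1 : ~ sim e a1) (e_w1 : ~ sim e w1).

(** Representatives of three classes exhaust ['I_3], so [sim] is equality. *)
Let cover x : [\/ x = e, x = a1 | x = w1].
Proof.
have ea : e <> a1 by move=> E; apply: e_a1; rewrite E; apply: sim_refl; case: dom_gens.
have ew : e <> w1 by move=> E; apply: e_w1; rewrite E; apply: sim_refl; case: dom_gens.
have aw : a1 <> w1.
  by move=> E; apply: sim_a1_w1; rewrite -E; apply: sim_refl; case: dom_gens.
move: ea ew aw; elim/ord3P: x; elim/ord3P: (e); elim/ord3P: (a1); elim/ord3P: (w1) => //;
  by [constructor 1 | constructor 2 | constructor 3].
Qed.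

Let dom_all x : dom x.
Proof. by have [da dw] := dom_gens; case: (cover x) => ->. Qed.

Let sim_eq x x' : sim x x' -> x = x'.
Proof.
move=> s; have s' := sim_sym s; have := sim_a1_w1.
by case: (cover x) (cover x') s s' => -> [] ->.
Qed.

(** In the Latin square, the passage from the line [w3] to the line [a3] along a common [y]. *)
Let psi x x' := exists y, crit x y w3 /\ crit x' y a3.

Let psi_total x : exists x', psi x x'.
Proof.
have [y c] := dom_w3 (dom_all x); have [x' c'] := crit_a3 c.
by exists x', y.
Qed.

Let psi_irr x x' : psi x x' -> x <> x'.
Proof. by case=> y [c c'] E; rewrite -E in c'; apply: crit_a3_w3 c c'. Qed.

Let psi_fun x x1 x2 : psi x x1 -> psi x x2 -> x1 = x2.
Proof.
case=> y1 [c1 c1'] [y2 [c2 c2']]; apply: sim_eq; exists y2, a3; split=> //.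
exact: crit_fork2 c1 c2 c1'.
Qed.

Let psi_inj x1 x2 x : psi x1 x -> psi x2 x -> x1 = x2.
Proof.
case=> y1 [c1 c1'] [y2 [c2 c2']]; apply: sim_eq; exists y2, w3; split=> //.
exact: crit_fork2 c1' c2' c1.
Qed.

Let psi_closed n (f : op 'I_3 n) (U V : 'I_n -> 'I_3) : C f ->
  (forall i, psi (U i) (V i)) -> psi (f (finfun U)) (f (finfun V)).
Proof.
move=> Cf /fin_all_exists[Y c]; exists (f (finfun Y)).
have const (k : 'I_3) : f (finfun (fun=> k)) = k by apply: C_idem.
split; [rewrite -(const w3) | rewrite -(const a3)];
  by apply: crit_closed => // i; case: (c i).
Qed.

(** [psi] is an invariant permutation of three points without fixed point, hence a 3-cycle: [phi] or
    its converse. *)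
Lemma three_classes_phi : clone_preserves C phi.
Proof.
have [[p0 h0] [p1 h1] [p2 h2]] := And3 (psi_total i0) (psi_total i1) (psi_total i2).
have n0 := psi_irr h0; have n1 := psi_irr h1; have n2 := psi_irr h2.
have n01 : p0 <> p1 by move=> E; rewrite -E in h1; have := psi_inj h0 h1.
have n02 : p0 <> p2 by move=> E; rewrite -E in h2; have := psi_inj h0 h2.
have n12 : p1 <> p2 by move=> E; rewrite -E in h2; have := psi_inj h1 h2.
have psiE : (forall x y, psi x y <-> phi [ffun j : 'I_2 => if j == ord0 then x else y]) \/
            (forall x y, psi y x <-> phi [ffun j : 'I_2 => if j == ord0 then x else y]).
  have dec x y : psi x y -> forall z, psi x z -> z = y by move=> h z h'; exact: psi_fun h' h.
  have d0 := dec _ _ h0; have d1 := dec _ _ h1; have d2 := dec _ _ h2.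
  move: n0 n1 n2 n01 n02 n12 h0 h1 h2 d0 d1 d2.
  elim/ord3P: p0; elim/ord3P: p1; elim/ord3P: p2 => // _ _ _ _ _ _ h0 h1 h2 d0 d1 d2;
  [left|right] => x y; rewrite /phi !ffunE /=;
  elim/ord3P: x; elim/ord3P: y; split=> // h;
  by [have := d0 _ h | have := d1 _ h | have := d2 _ h].
move=> n f Cf rows phi_rows.
pose U i := rows i ord0; pose V i := rows i (lift ord0 ord0).
have pE (v : {ffun 'I_2 -> 'I_3}) :
    v = [ffun j => if j == ord0 then v ord0 else v (lift ord0 ord0)].
  apply/ffunP => j; rewrite ffunE; case: (unliftP ord0 j) => [k|] ->; rewrite ?eqxx //.
  by rewrite (_ : k = ord0) //; apply: val_inj; case: k => [[]].
rewrite (pE [ffun j => f _]) !ffunE; case: psiE => psiE.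
- have := psi_closed Cf (U := U) (V := V); rewrite psiE; apply=> i.
  by rewrite psiE /U /V -pE.
- have := psi_closed Cf (U := V) (V := U); rewrite psiE; apply=> i.
  by rewrite psiE /U /V -pE.
Qed.

End ThreeClasses.

(** * Two classes: an affine quotient *)

Section TwoClasses.
Hypothesis two_classes : forall x, dom x -> sim x a1 \/ sim x w1.
Variable q : pred 'I_3.
Hypothesis qP : forall x, q x <-> sim x a1.

Let q_a1 : q a1. Proof. by apply/qP/sim_refl; case: dom_gens. Qed.

Let q_w1 : q w1 = false.
Proof. by apply/negP => /qP/sim_sym; apply: sim_a1_w1. Qed.

Let q_sim x y : dom x -> dom y -> sim x y <-> q x = q y.
Proof.
move=> dx dy; split=> [s | qxy].
  by apply/idP/idP => /qP s'; apply/qP; [apply: sim_trans (sim_sym s) s' | apply: sim_trans s s'].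
have [qx | nqx] := boolP (q x).
  have sx := proj1 (qP x) qx; rewrite qxy in qx; have sy := proj1 (qP y) qx.
  exact: sim_trans sx (sim_sym sy).
have sN z : dom z -> ~~ q z -> sim z w1.
  by move=> /two_classes[/qP -> //|].
by apply: sim_trans (sN x dx nqx) (sim_sym (sN y dy _)); rewrite -qxy.
Qed.

(** If [d w1 a1 w1] were congruent to [w1], then [w1], [a2] would occur with both [w3] and [a3]. *)
Let crit_a : crit a1 a2 a3.
Proof.
have [g1 g2 g3] := crit_gens; have c := crit_a2_a3.
have [s|s] : sim (d w1 a1 w1) a1 \/ sim (d w1 a1 w1) w1.
- by apply: two_classes; exists a2, a3.
- exact: sim_crit s c.
- by case: (crit_a3_w3 g2 (sim_crit s c)).
Qed.

(** Reading [a] as 1 and [w] as 0, the generators and [crit_a] are the four triples of odd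
    parity. *)
Let crit_bits x b2 b3 : dom x -> q x (+) b2 (+) b3 ->
  crit x (if b2 then a2 else w2) (if b3 then a3 else w3).
Proof.
have [g1 g2 g3] := crit_gens => dx.
have [qx | nqx] := boolP (q x).
  have s : sim a1 x by apply/sim_sym/qP.
  by case: b2; case: b3 => // _; apply: sim_crit s _.
have s : sim w1 x by case: (two_classes dx) => [/qP|/sim_sym //]; rewrite (negPf nqx).
by case: b2; case: b3 => // _; apply: sim_crit s _.
Qed.

Let crit_parity x y z u p p' r r' :
  crit x p r -> crit y p' r -> crit z p r' -> crit u p' r' -> sim x y -> sim z u.
Proof.
move=> cx cy cz cu s; exists p', r'; split=> //.
exact: crit_fork2 (sim_crit s cx) cy cz.
Qed.

Lemma section_affine n (f : op 'I_3 n) (U V W T : 'I_n -> 'I_3) : C f ->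
  (forall i, [/\ dom (U i), dom (V i), dom (W i) & dom (T i)]) ->
  (forall i, q (T i) = q (U i) (+) q (V i) (+) q (W i)) ->
  q (f (finfun T)) = q (f (finfun U)) (+) q (f (finfun V)) (+) q (f (finfun W)).
Proof.
move=> Cf doms qT.
(* The rows are completed to triples of odd parity forming a rectangle: [U], [W] share [P]; [V], [T]
   share [P']; [U], [V] share [R]; [W], [T] share [R']. *)
pose P i := if ~~ q (U i) then a2 else w2; pose P' i := if ~~ q (V i) then a2 else w2.
pose R (i : 'I_n) := w3; pose R' i := if q (U i) (+) q (W i) then a3 else w3.
have cU : crit (f (finfun U)) (f (finfun P)) (f (finfun R)).
  by apply: crit_closed => // i; apply: (@crit_bits _ _ false); [case: (doms i) | case: q].
have cV : crit (f (finfun V)) (f (finfun P')) (f (finfun R)).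
  by apply: crit_closed => // i; apply: (@crit_bits _ _ false); [case: (doms i) | case: q].
have cW : crit (f (finfun W)) (f (finfun P)) (f (finfun R')).
  by apply: crit_closed => // i; apply: crit_bits; [case: (doms i) | case: q; case: q].
have cT : crit (f (finfun T)) (f (finfun P')) (f (finfun R')).
  apply: crit_closed => // i; apply: crit_bits; first by case: (doms i).
  by rewrite qT; case: q; case: q; case: q.
have dm X : (forall i, dom (X i)) -> dom (f (finfun X)) by apply: dom_closed.
have dU : dom (f (finfun U)) by apply: dm => i; case: (doms i).
have dV : dom (f (finfun V)) by apply: dm => i; case: (doms i).
have dW : dom (f (finfun W)) by apply: dm => i; case: (doms i).
have dT : dom (f (finfun T)) by apply: dm => i; case: (doms i).
(* Both directions together: [U] and [V] give congruent values exactly when [W] and [T] do. *)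
have := @crit_parity _ _ _ _ _ _ _ _ cU cV cW cT.
have := @crit_parity _ _ _ _ _ _ _ _ cW cT cU cV.
rewrite !q_sim //; case: (q (f _)); case: (q (f _)); case: (q (f _)); case: (q (f _)) => //;
  by [move=> /(_ erefl) | move=> _ /(_ erefl)].
Qed.

Lemma section_malcev x y z : dom x -> dom y -> dom z ->
  dom (d x y z) /\ q (d x y z) = q x (+) q y (+) q z.
Proof.
move=> dx dy dz; split.
  by rewrite -(tern_tri d); apply: dom_closed => //; apply: ord3P.
pose vec (x' y' z' : 'I_3) (i : 'I_3) := if val i == 0 then x' else if val i == 1 then y' else z'.
have dE x' y' z' : d x' y' z' = tern d (finfun (vec x' y' z')) by rewrite -(tern_tri d).
(* Modulo 2, (x,y,z) = (x,y,y) + (y,y,y) + (y,y,z), and [d] is known on the right. *)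
have -> : q x (+) q y (+) q z = q (d x y y) (+) q (d y y y) (+) q (d y y z).
  by rewrite d_left !d_right.
rewrite !dE; apply: section_affine => //; apply: ord3P => //=; by case: q; case: q.
Qed.

(** The action on the quotient by [sim], with representatives [a1] for 1 and [w1] for 0. *)
Definition section_hom n (f : op 'I_3 n) : op 'I_2 n :=
  [ffun v : {ffun 'I_n -> 'I_2} => inord (q (f [ffun i => if odd (v i) then a1 else w1]))].

Lemma section_hom_Z2 : minion_hom C Z2 section_hom.
Proof.
have val_inord (b : bool) : val (inord b : 'I_2) = b by rewrite /= inordK //; case: b.
have q_rep (b : 'I_2) : q (if odd b then a1 else w1) = odd b.
  by case: odd; [exact: q_a1 | exact: q_w1].
have dom_rep (b : 'I_2) : dom (if odd b then a1 else w1) by case: dom_gens; case: odd.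
split=> [n f Cf|n r sigma f Cf]; last first.
  apply/ffunP => v; rewrite !ffunE; congr (inord (q (f _))).
  by apply/ffunP => i; rewrite !ffunE.
split; [|split] => rows rowsP.
- rewrite /affine_rel !ffunE !val_inord modn2 !oddD !oddb.
  apply/eqP; congr nat_of_bool; apply: section_affine => // i; rewrite ?q_rep !ffunE ?q_rep //.
  by rewrite (eqP (rowsP i)) modn2 oddb !oddD.
- rewrite /const_rel !ffunE val_inord (_ : [ffun i => _] = [ffun=> w1]).
    by rewrite C_idem // q_w1.
  by apply/ffunP => i; rewrite !ffunE (eqP (rowsP i)).
- rewrite /const_rel !ffunE val_inord (_ : [ffun i => _] = [ffun=> a1]).
    by rewrite C_idem // q_a1.
  by apply/ffunP => i; rewrite !ffunE (eqP (rowsP i)).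
Qed.

End TwoClasses.
End Critical.

Lemma affine_section (C : opfam 'I_3) d :
  is_clone C -> idempotent_clone C -> in_tern C d ->
  (forall x y, d y x x = y) -> (forall x y, d x x y = y) ->
  ~ has_majority C -> ~ clone_preserves C phi ->
  (exists xi, minion_hom C Z2 xi) /\
  exists dom q : pred 'I_3,
    (exists a w, [/\ dom a, dom w, q a & ~~ q w]) /\
    forall x y z, dom x -> dom y -> dom z ->
      dom (d x y z) /\ q (d x y z) = q x (+) q y (+) q z.
Proof.
move=> C_clone C_idem Cd dl dr noM noP.
have [a1 [w1 [a2 [w2 [a3 [w3 bad]]]]]] : exists a1 w1 a2 w2 a3 w3, ~ exists t,
    in_tern C t /\ [/\ t a1 w1 w1 = w1, t w2 a2 w2 = w2 & t w3 w3 a3 = w3].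
  apply: NNPP => none; case: noM; apply: majority_of_local => // a1 w1 a2 w2 a3 w3.
  by apply: NNPP => bad; apply: none; exists a1, w1, a2, w2, a3, w3.
have two x : dom C a1 w1 a2 w2 a3 w3 x ->
    sim C a1 w1 a2 w2 a3 w3 x a1 \/ sim C a1 w1 a2 w2 a3 w3 x w1.
  move=> dx; apply: NNPP => /not_or_and[sa sw]; case: noP.
  exact: (three_classes_phi C_clone C_idem Cd dl dr bad dx sa sw).
have [q qP] := prop_bool (fun x => sim C a1 w1 a2 w2 a3 w3 x a1).
have [D DP] := prop_bool (dom C a1 w1 a2 w2 a3 w3).
split.
  exists (section_hom a1 w1 q).
  exact: (section_hom_Z2 C_clone C_idem Cd dl dr bad two qP).
have [da dw] := dom_gens C_clone a1 w1 a2 w2 a3 w3.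
exists D, q; split.
  exists a1, w1; split; try by apply/DP.
  - by apply/qP/sim_refl.
  - by apply/negP => /qP/sim_sym; exact: (sim_a1_w1 C_clone Cd dl dr bad).
move=> x y z /DP dx /DP dy /DP dz.
have [dd qd] := section_malcev C_clone Cd dl dr bad two qP dx dy dz.
by split=> //; apply/DP.
Qed.

(** * Transport between ['I_3] and letters *)

Definition elt_nat (x : elt) := match x with E0 => 0 | E1 => 1 | E2 => 2 end.

(** The rotation by [c] lets any element play the role of the letter 0 in the checked tables. *)
Definition enc (c : 'I_3) (x : elt) : 'I_3 := Ordinal (@ltn_pmod (c + elt_nat x) 3 isT).

Definition dec (c y : 'I_3) : elt :=
  match (y + (3 - c)) %% 3 with 0 => E0 | 1 => E1 | _ => E2 end.

Lemma encK c : cancel (enc c) (dec c).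
Proof. by elim/ord3P: c; case. Qed.

Lemma decK c : cancel (dec c) (enc c).
Proof. by elim/ord3P: c; apply: ord3P; apply: val_inj. Qed.

Definition minority3 (T : Type) (m : T -> T -> T -> T) :=
  forall x y, [/\ m x y y = x, m y x y = x & m y y x = x].

Lemma is_minorityP d : is_minority d -> minority3 (lookup d).
Proof.
move=> /all_eltP h x y.
by case/and3P: (all_eltP (h x) y) => /eq_eltP-> /eq_eltP-> /eq_eltP->.
Qed.

Lemma table_of_malcev (f : fun3) : (forall x y, f x y y = x /\ f y y x = x) ->
  table_of f = malcev_table (f E0 E1 E0) (f E0 E2 E0) (f E1 E0 E1) (f E1 E2 E1)
    (f E2 E0 E2) (f E2 E1 E2) (f E0 E1 E2) (f E0 E2 E1) (f E1 E0 E2) (f E1 E2 E0)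
    (f E2 E0 E1) (f E2 E1 E0).
Proof.
move=> fM; rewrite /table_of /tabulate /malcev_table.
by rewrite !(fun x y => proj1 (fM x y)) !(fun x y => proj2 (fM x y)).
Qed.

Section Elt.
Variable C : opfam 'I_3.
Hypothesis C_clone : is_clone C.
Variable c : 'I_3.

Definition in_elt (t : fun3) :=
  in_tern C (fun x y z => enc c (t (dec c x) (dec c y) (dec c z))).

Lemma eq_in_elt t u : (forall x y z, t x y z = u x y z) -> in_elt t -> in_elt u.
Proof.
move=> eq_tu; rewrite /in_elt /in_tern; congr (C _); apply: eq_tern => x y z.
by rewrite eq_tu.
Qed.

Lemma in_elt_proj :
  [/\ in_elt (fun x _ _ => x), in_elt (fun _ y _ => y) & in_elt (fun _ _ z => z)].
Proof.
have [pX pY pZ] := in_tern_proj C_clone.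
split; rewrite /in_elt /in_tern; [move: pX|move: pY|move: pZ];
  by congr (C _); apply: eq_tern => x y z; rewrite decK.
Qed.

Lemma in_elt_comp t u1 u2 u3 : in_elt t -> in_elt u1 -> in_elt u2 -> in_elt u3 ->
  in_elt (fun x y z => t (u1 x y z) (u2 x y z) (u3 x y z)).
Proof.
move=> Ct C1 C2 C3; have := in_tern_comp C_clone Ct C1 C2 C3.
by rewrite /in_elt /in_tern; congr (C _); apply: eq_tern => x y z; rewrite !encK.
Qed.

Lemma in_elt_tern (f : 'I_3 -> 'I_3 -> 'I_3 -> 'I_3) : in_tern C f ->
  in_elt (fun x y z => dec c (f (enc c x) (enc c y) (enc c z))).
Proof.
by rewrite /in_elt /in_tern; congr (C _); apply: eq_tern => x y z; rewrite !decK.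
Qed.

Lemma in_elt_eval d t : in_elt (lookup d) -> in_elt (eval d t).
Proof.
have [pX pY pZ] := in_elt_proj => Cd.
by elim: t => [|||u1 h1 u2 h2 u3 h3] //; apply: in_elt_comp.
Qed.

Lemma in_elt_table t : in_elt t -> in_elt (lookup (table_of t)).
Proof. by apply: eq_in_elt => x y z; rewrite lookup_table_of. Qed.

Lemma in_elt_run keep stop d w :
  in_elt (lookup d) -> in_elt (lookup (run keep stop d w)).
Proof.
elim: w d => //= t w IHw d Cd; apply: IHw; rewrite /step.
by case: ifP => // _; case: ifP => // _; apply/in_elt_table/in_elt_eval.
Qed.

End Elt.

(** * From an affine section to a minority operation *)

Section Minority.
Variable C : opfam 'I_3.
Hypothesis C_clone : is_clone C.
Variables (c : 'I_3) (d : fun3).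
Hypotheses (Cd : in_elt C c d) (d_malcev : forall x y, d x y y = x /\ d y y x = x).

Lemma minority_of_subalgebra : d E1 E2 E1 = E2 -> d E2 E1 E2 = E1 ->
  exists m, in_elt C c m /\ minority3 m.
Proof.
move=> d12 d21.
exists (lookup (run is_malcev is_minority (table_of d) minority_word)); split.
  by apply: in_elt_run => //; apply: in_elt_table.
rewrite (table_of_malcev d_malcev) d12 d21; apply: is_minorityP.
exact: sub_check.
Qed.

Lemma minority_of_quotient :
  [/\ d E0 E1 E0 <> E0, d E0 E2 E0 <> E0, d E1 E2 E1 <> E0 & d E2 E1 E2 <> E0] ->
  [/\ d E1 E0 E1 = E0, d E2 E0 E2 = E0, d E0 E1 E2 = E0 & d E0 E2 E1 = E0] ->
  [/\ d E1 E0 E2 = E0, d E1 E2 E0 = E0, d E2 E0 E1 = E0 & d E2 E1 E0 = E0] ->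
  exists m, in_elt C c m /\ minority3 m.
Proof.
move=> [n1 n2 n3 n4] [e1 e2 e3 e4] [e5 e6 e7 e8].
exists (lookup (run is_malcev is_minority (table_of d) minority_word)); split.
  by apply: in_elt_run => //; apply: in_elt_table.
rewrite (table_of_malcev d_malcev) e1 e2 e3 e4 e5 e6 e7 e8; apply: is_minorityP.
have := quo_check (d E0 E1 E0) (d E0 E2 E0) (d E1 E2 E1) (d E2 E1 E2).
move/implyP; apply; move: n1 n2 n3 n4.
by case: (d E0 E1 E0); case: (d E0 E2 E0); case: (d E1 E2 E1); case: (d E2 E1 E2).
Qed.

End Minority.

Lemma minority_of_section (C : opfam 'I_3) d (dom q : pred 'I_3) :
  is_clone C -> in_tern C d ->
  (forall x y, d y x x = y) -> (forall x y, d x x y = y) ->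
  (exists a w, [/\ dom a, dom w, q a & ~~ q w]) ->
  (forall x y z, dom x -> dom y -> dom z ->
     dom (d x y z) /\ q (d x y z) = q x (+) q y (+) q z) ->
  exists m, in_tern C m /\ minority3 m.
Proof.
move=> C_clone Cd dl dr [a [w [da dw qa qw]]] dq.
suff [c [m [Cm mP]]] : exists c m, in_elt C c m /\ minority3 m.
  exists (fun x y z => enc c (m (dec c x) (dec c y) (dec c z))); split=> // x y.
  by have [-> -> ->] := mP (dec c x) (dec c y); rewrite !decK.
pose dE c x y z := dec c (d (enc c x) (enc c y) (enc c z)).
have CdE c : in_elt C c (dE c) by apply: in_elt_tern.
have dM c x y : dE c x y y = x /\ dE c y y x = x by rewrite /dE dl dr encK.
have dqE c x y z : dom (enc c x) -> dom (enc c y) -> dom (enc c z) ->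
    dom (enc c (dE c x y z)) /\
    q (enc c (dE c x y z)) = q (enc c x) (+) q (enc c y) (+) q (enc c z).
  by rewrite /dE decK; apply: dq.
(* The distinguished [x] is either outside a two-element section or alone in its class when the
   section is everything; a rotation makes it 0. *)
pose sub x y z := [&& ~~ dom x, dom y, dom z & q y != q z].
pose quo x y z := [&& dom x, dom y, dom z, q y == q z & q y != q x].
have [c hc] : exists c, sub (enc c E0) (enc c E1) (enc c E2) ||
                        quo (enc c E0) (enc c E1) (enc c E2).
  have encE (c : 'I_3) x (k : 'I_3) : val k = (c + elt_nat x) %% 3 -> enc c x = k.
    by move=> e; apply: val_inj.
  have : [|| sub i0 i1 i2 || quo i0 i1 i2, sub i1 i2 i0 || quo i1 i2 i0
           | sub i2 i0 i1 || quo i2 i0 i1].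
    move: da dw qa qw; rewrite /sub /quo; elim/ord3P: a; elim/ord3P: w;
    by case: (dom i0); case: (dom i1); case: (dom i2); case: (q i0); case: (q i1); case: (q i2).
  case/or3P => h; [exists i0 | exists i1 | exists i2].
  - by rewrite (@encE i0 E0 i0) // (@encE i0 E1 i1) // (@encE i0 E2 i2).
  - by rewrite (@encE i1 E0 i1) // (@encE i1 E1 i2) // (@encE i1 E2 i0).
  - by rewrite (@encE i2 E0 i2) // (@encE i2 E1 i0) // (@encE i2 E2 i1).
exists c; case/orP: hc => [/and4P[nD0 D1 D2 nq]|/and5P[D0 D1 D2 /eqP eq12 nq]].
  apply: minority_of_subalgebra (CdE c) (dM c) _ _ => //.
  - have [] := dqE c E1 E2 E1 D1 D2 D1; case: (dE c E1 E2 E1) => //; first by rewrite (negPf nD0).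
    by move=> _; move: nq; case: (q (enc c E1)); case: (q (enc c E2)).
  - have [] := dqE c E2 E1 E2 D2 D1 D2; case: (dE c E2 E1 E2) => //; first by rewrite (negPf nD0).
    by move=> _; move: nq; case: (q (enc c E1)); case: (q (enc c E2)).
have Dall x : dom (enc c x) by case: x.
have qd x y z := proj2 (dqE c x y z (Dall x) (Dall y) (Dall z)).
have q0 x : x = E0 <-> q (enc c x) = q (enc c E0).
  by case: x; split=> // h; move: nq; rewrite ?eq12 ?h ?eqxx // -eq12 h eqxx.
have toE0 x y z : q (enc c x) (+) q (enc c y) (+) q (enc c z) = q (enc c E0) ->
  dE c x y z = E0 by move=> h; apply/q0; rewrite qd.
have notE0 x y z : q (enc c x) (+) q (enc c y) (+) q (enc c z) <> q (enc c E0) ->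
  dE c x y z <> E0 by move=> h /q0; rewrite qd.
by apply: minority_of_quotient (CdE c) (dM c) _ _ _ => //; split;
   first [apply: toE0 | apply: notE0]; move: nq; rewrite eq12;
   case: (q (enc c E0)); case: (q (enc c E2)).
Qed.

(** * From a minority operation to a symmetric one *)

Section Sum.
Variable C : opfam 'I_3.
Hypotheses (C_clone : is_clone C) (C_idem : idempotent_clone C).

Notation in_elt := (in_elt C i0).

Definition breaks_cycle (f : fun3) := ~~ shift_on_cycle (f E0 E1 E2) (f E1 E2 E0) (f E2 E0 E1).

Lemma in_elt_idem f x : in_elt f -> f x x x = x.
Proof. by move/(in_tern_idem C_idem (enc i0 x)); rewrite !encK => /(can_inj (@encK i0)). Qed.

(** Variables of a violating [f] are identified when their rows have the same first entry; the two
    columns then become (0,1,2) and (1,2,0). *)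
Lemma in_elt_breaks_cycle : ~ clone_preserves C phi -> exists f, in_elt f /\ breaks_cycle f.
Proof.
move=> noP.
have [n [f [Cf [rows [rowsP nphi]]]]] : exists n (f : op 'I_3 n), C f /\ exists rows,
    (forall i, phi (rows i)) /\ ~ phi [ffun j => f [ffun i => rows i j]].
  apply: NNPP => none; apply: noP => n f Cf rows rowsP; apply: NNPP => nphi.
  by apply: none; exists n, f; split=> //; exists rows.
pose s i := rows i ord0.
have := in_elt_tern i0 (in_tern_app (in_clone_minor C_clone s Cf)).
set g := (X in in_elt X) => Cg; exists g; split=> //.
apply/negP => /andP[/eq_eltP gE _]; apply: nphi.
have e012 : f [ffun i => s i] = enc i0 (g E0 E1 E2).
  rewrite /g decK ffunE; congr (f _); apply/ffunP => i; rewrite !ffunE.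
  by elim/ord3P: (s i); apply: val_inj.
have e120 : f [ffun i => rows i (lift ord0 ord0)] = enc i0 (g E1 E2 E0).
  rewrite /g decK ffunE; congr (f _); apply/ffunP => i; rewrite !ffunE.
  move: (rowsP i); rewrite /phi /s.
  by elim/ord3P: (rows i ord0); elim/ord3P: (rows i _) => // _; apply: val_inj.
rewrite /phi !ffunE -/s e012 e120 gE.
by case: (g E0 E1 E2).
Qed.

(* If [m] acts as the first projection on the cyclic orbit of (0, 1, 2), then
   [P1] and [P2] below coincide there with the third variable while being [x]
   and [y] wherever two arguments agree; this isolates the effect of [f] on
   that orbit. *)
Lemma minority_copies (m f : fun3) : in_elt m -> minority3 m -> in_elt f ->
  m E0 E1 E2 = E0 -> m E1 E2 E0 = E1 -> m E2 E0 E1 = E2 ->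
  exists m', [/\ in_elt m', minority3 m', m' E0 E1 E2 = f E0 E1 E2,
    m' E1 E2 E0 = f E1 E2 E0 & m' E2 E0 E1 = f E2 E0 E1].
Proof.
move=> Cm mP Cf m0 m1 m2; have [pX pY pZ] := in_elt_proj C_clone i0.
have comp := in_elt_comp C_clone.
pose P1 x y z := m (m y z x) y z; pose P2 x y z := m (m x y z) x z.
have CP1 : in_elt P1 := comp _ _ _ _ _ Cm (comp _ _ _ _ _ Cm pY pZ pX) pY pZ.
have CP2 : in_elt P2 := comp _ _ _ _ _ Cm (comp _ _ _ _ _ Cm pX pY pZ) pX pZ.
pose f' x y z := f (P1 x y z) (P2 x y z) z.
have Cf' : in_elt f' := comp _ _ _ _ _ Cf CP1 CP2 pZ.
(* On the orbit [f'] is [z], so [h] is [f]; where two arguments agree [f'] is [f], so [h] is [z]. *)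
pose h x y z := m z (f x y z) (f' x y z).
have Ch : in_elt h := comp _ _ _ _ _ Cm pZ Cf Cf'.
have mE x y : (m x y y = x) * (m y x y = x) * (m y y x = x) by have [-> -> ->] := mP x y.
have fE x := in_elt_idem x Cf.
exists (fun x y z => m (m z x y) z (h x y z)); split.
- exact: (comp _ _ _ _ _ Cm (comp _ _ _ _ _ Cm pZ pX pY) pZ Ch).
- by move=> x y; rewrite /h /f' /P1 /P2 !mE; split; rewrite ?mE.
- by rewrite /h /f' /P1 /P2 !(m0, m1, m2) !mE fE !mE.
- by rewrite /h /f' /P1 /P2 !(m0, m1, m2) !mE fE !mE.
- by rewrite /h /f' /P1 /P2 !(m0, m1, m2) !mE fE !mE.
Qed.

Lemma minority_breaks_cycle m f : in_elt m -> minority3 m -> in_elt f -> breaks_cycle f ->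
  exists m', [/\ in_elt m', minority3 m' & breaks_cycle m'].
Proof.
move=> Cm mP Cf fB.
have [mB|] := boolP (breaks_cycle m); first by exists m.
rewrite negbK => /andP[/eq_eltP e1 /eq_eltP e2].
have [pX pY pZ] := in_elt_proj C_clone i0.
have comp := in_elt_comp C_clone.
have [m' [Cm' mP' m0 [m1 m2]]] : exists m', [/\ in_elt m', minority3 m', m' E0 E1 E2 = E0 &
    m' E1 E2 E0 = E1 /\ m' E2 E0 E1 = E2].
  (* Commuting with the shift, [m] is a projection on the orbit; rotating its arguments makes it the
     first. *)
  case E: (m E0 E1 E2) e1 e2 => /= e1; rewrite e1 /= => e2.
  - by exists m.
  - exists (fun x y z => m z x y); split=> //; first exact: (comp _ _ _ _ _ Cm pZ pX pY).
    by move=> x y; have [] := mP x y.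
  - exists (fun x y z => m y z x); split=> //; first exact: (comp _ _ _ _ _ Cm pY pZ pX).
    by move=> x y; have [] := mP x y.
have [m'' [C'' P'' f0 f1 f2]] := minority_copies Cm' mP' Cf m0 m1 m2.
by exists m''; split=> //; rewrite /breaks_cycle f0 f1 f2.
Qed.

Lemma gen_sum_in_clone m : in_elt m -> minority3 m -> ~ clone_preserves C phi ->
  exists c, in_elt (gen_sum c).
Proof.
move=> Cm mP /in_elt_breaks_cycle[f [Cf fB]].
have {m Cm mP f Cf fB} [m [Cm mP mB]] := minority_breaks_cycle Cm mP Cf fB.
suff [d [Cd dS]] : exists d, in_elt (lookup d) /\ is_some_sum d.
  have sumP c : is_sum c d -> in_elt (gen_sum c).
    move=> /all_eltP h; apply: eq_in_elt Cd => x y z.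
    by have /all_eltP/(_ y)/all_eltP/(_ z)/eq_eltP := h x.
  by case/or3P: dS => /sumP; [exists E0 | exists E1 | exists E2].
exists (run is_minority is_some_sum (table_of m) sum_word).
split; first by apply: in_elt_run => //; apply: in_elt_table.
have mM x y : m x y y = x /\ m y y x = x by have [] := mP x y.
rewrite (table_of_malcev mM).
have mE x y : m x y x = y by have [] := mP y x.
rewrite !mE; have := sum_check (m E0 E1 E2) (m E0 E2 E1) (m E1 E0 E2) (m E1 E2 E0)
  (m E2 E0 E1) (m E2 E1 E0).
by move/implyP; apply.
Qed.

End Sum.

(* The letter at which [b] is true if there is exactly one, and [c] if [b] is
   true everywhere; the other cases have even parity and do not occur. *)
Definition odd_elt (c : elt) (b : elt -> bool) : elt :=
  match b E0, b E1, b E2 with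
  | true, false, false => E0
  | false, true, false => E1
  | false, false, true => E2
  | _, _, _ => c
  end.

Lemma eq_odd_elt c b b' : b =1 b' -> odd_elt c b = odd_elt c b'.
Proof. by move=> eqb; rewrite /odd_elt !eqb. Qed.

Definition odd_count n (l : seq 'I_n) (x : {ffun 'I_n -> 'I_3}) (a : elt) :=
  odd (count (fun i => eq_elt (dec i0 (x i)) a) l).

Lemma odd_count_sum n (l : seq 'I_n) x :
  odd_count l x E0 (+) odd_count l x E1 (+) odd_count l x E2 = odd (size l).
Proof.
rewrite /odd_count -!oddD; congr odd; elim: l => //= i l <-.
by case: (dec i0 (x i)); rewrite ?add1n ?add0n ?addSn ?addnS.
Qed.

(* The equivalence with classes {c} and its complement is a congruence of
   [gen_sum c], with quotient Z/2. Each of [h1], [h2], [h3] equals the left-hand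
   side when the two letters it adds last are congruent, and two of [i], [u], [v]
   always are. For [x] different from [c], [p x y z] is [x] if [y] and [z] are
   congruent, and otherwise the one of [y], [z] that is not [c]. *)
Lemma odd_elt_step c (s : elt -> bool) i u v : ~~ (s E0 (+) s E1 (+) s E2) ->
  let g := gen_sum c in let p x y z := g (g x y z) y z in
  let add a t := eq_elt a t (+) s t in
  let h1 := g (odd_elt c (add i)) u v in
  let h2 := g (odd_elt c (add u)) i v in
  let h3 := g (odd_elt c (add v)) i u in
  odd_elt c (fun t => eq_elt i t (+) (eq_elt u t (+) (eq_elt v t (+) s t))) =
  p h1 (p (g h2 i v) h2 u) (p (g h3 i u) h3 v).
Proof.
by rewrite /odd_elt; case: (s E0); case: (s E1); case: (s E2) => // _; case: c i u v => [] [] [] [].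
Qed.

(** * Sums of odd length and the homomorphism from [Z2] *)

Section FromZ2.
Variable C : opfam 'I_3.
Hypothesis C_clone : is_clone C.
Variable c : elt.
Hypothesis C_sum : in_elt C i0 (gen_sum c).

Let inC n (F : {ffun 'I_n -> 'I_3} -> elt) := C [ffun x => enc i0 (F x)].

Let inC_sum n (F1 F2 F3 : {ffun 'I_n -> 'I_3} -> elt) : inC F1 -> inC F2 -> inC F3 ->
  inC (fun x => gen_sum c (F1 x) (F2 x) (F3 x)).
Proof.
move=> C1 C2 C3; have := in_clone_comp3 C_clone C_sum C1 C2 C3.
by rewrite /inC; congr (C _); apply/ffunP => x; rewrite !ffunE !encK.
Qed.

Let inC_var n (i : 'I_n) : inC (fun x => dec i0 (x i)).
Proof.
case: C_clone => /(_ n i) Ci _; move: Ci; rewrite /inC; congr (C _).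
by apply/ffunP => x; rewrite !ffunE decK.
Qed.

Let inC_sel n (F1 F2 F3 : {ffun 'I_n -> 'I_3} -> elt) : inC F1 -> inC F2 -> inC F3 ->
  inC (fun x => gen_sum c (gen_sum c (F1 x) (F2 x) (F3 x)) (F2 x) (F3 x)).
Proof. by move=> C1 C2 C3; apply: inC_sum => //; apply: inC_sum. Qed.

(** Induction by two variables: [odd_elt_step] rebuilds the sum over [i], [u], [v] and [l] from the
    three sums over one of them and [l]. *)
Lemma odd_elt_in_clone n (l : seq 'I_n) : odd (size l) ->
  C [ffun x => enc i0 (odd_elt c (odd_count l x))].
Proof.
rewrite -/(inC (fun x => odd_elt c (odd_count l x))).
have [m] := ubnP (size l); elim: m l => // m IHm [|i [|u [|v l]]] //.
  move=> _ _; have := @inC_var n i; rewrite /inC; congr (C _); apply/ffunP => x.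
  by rewrite !ffunE /odd_count /odd_elt /=; case: (dec i0 (x i)).
rewrite /= !ltnS negbK => lt_lm odd_l.
have IH k : inC (fun x => odd_elt c (odd_count (k :: l) x)).
  by apply: IHm; [exact: ltnW lt_lm | rewrite /= odd_l].
have C1 := inC_sum (IH i) (inC_var u) (inC_var v).
have C2 := inC_sum (IH u) (inC_var i) (inC_var v).
have C3 := inC_sum (IH v) (inC_var i) (inC_var u).
have CY := inC_sel (inC_sum C2 (inC_var i) (inC_var v)) C2 (inC_var u).
have CZ := inC_sel (inC_sum C3 (inC_var i) (inC_var u)) C3 (inC_var v).
have := inC_sel C1 CY CZ; rewrite /inC; congr (C _); apply/ffunP => x; rewrite !ffunE.
have oddS k l' t : odd_count (k :: l') x t = eq_elt (dec i0 (x k)) t (+) odd_count l' x t.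
  by rewrite /odd_count /= oddD oddb.
have step := odd_elt_step c (dec i0 (x i)) (dec i0 (x u)) (dec i0 (x v))
  (s := odd_count l x).
congr enc; rewrite !(eq_odd_elt c (oddS _ l)) -step ?odd_count_sum //.
by apply: eq_odd_elt => t; rewrite !oddS.
Qed.

(** [f] is evaluated at the indicator of each letter. For [f] in [Z2] the three bits add up to
    [f(1,...,1) = 1], the odd parity that [odd_elt] expects. *)
Definition sum_hom n (f : op 'I_2 n) : op 'I_3 n :=
  [ffun x : {ffun 'I_n -> 'I_3} => enc i0 (odd_elt c (fun a =>
     odd (f [ffun i => inord (eq_elt (dec i0 (x i)) a)])))].

Lemma sum_hom_minion : minion_hom Z2 C sum_hom.
Proof.
split=> [n f [f_aff [f_0 f_1]]|n r sigma f _]; last first.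
  apply/ffunP => x; rewrite !ffunE; congr enc; apply: eq_odd_elt => a.
  by rewrite ffunE; congr (odd (f _)); apply/ffunP => i; rewrite !ffunE.
pose F (b : 'I_n -> bool) := odd (f [ffun i => inord (b i)]).
have val_inord (b : bool) : (inord b : 'I_2) = b :> nat by rewrite inordK //; case: b.
have odd_f v : odd (f v) = f v :> nat by case: (f v) => [[|[|]]].
have eqF b b' : b =1 b' -> F b = F b'.
  by move=> e; congr (odd (f _)); apply/ffunP => i; rewrite !ffunE e.
have F_const (b : bool) : preserves f (const_rel b) -> F (fun=> b) = b.
  move=> /(_ (fun=> [ffun=> inord b])); rewrite /const_rel !ffunE /= => h.
  have {h} /eqP h := h (fun i => introT eqP (val_inord b)).
  rewrite -[RHS]oddb -{}h; congr (odd (f _)); apply/ffunP => i; by rewrite !ffunE.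
have F0 := F_const false f_0; have F1 := F_const true f_1.
have FD b b' : F (fun i => b i (+) b' i) = F b (+) F b'.
  (* The third entry 0 turns the affine law into additivity; the fourth entry, the sum, is the
     default value of [nth]. *)
  pose row i := [ffun j : 'I_4 => inord (nth (b i (+) b' i) [:: b i; b' i; false] j) : 'I_2].
  have rowE i j : j < 4 -> row i (inord j) = inord (nth (b i (+) b' i) [:: b i; b' i; false] j).
    by move=> lt_j4; rewrite ffunE inordK.
  have colE j : j < 4 -> f [ffun i => row i (inord j)] =
      F (fun i => nth (b i (+) b' i) [:: b i; b' i; false] j) :> nat.
    move=> lt_j4; rewrite /F odd_f; congr (nat_of_ord (f _)).
    by apply/ffunP => i; rewrite !ffunE inordK.
  have := f_aff row; rewrite /affine_rel !ffunE /= !colE //= => h.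
  have /eqP : F (fun i => b i (+) b' i) == (F b + F b' + F (fun=> false)) %% 2 :> nat.
    by apply: h => i; rewrite !rowE // !val_inord modn2 !oddD !oddb /= addbF.
  by rewrite modn2 !oddD !oddb F0 addbF; case: (F b); case: (F b'); case: (F _).
have F_seq s : F (fun i => odd (count_mem i s)) = odd (count (fun i => F (pred1 i)) s).
  elim: s => [|k s IHs]; first exact: F0.
  by rewrite /= oddD oddb -IHs -FD; apply: eqF => i; rewrite /= oddD oddb eq_sym.
(* By additivity [f] is the sum of the variables in [l]; their number is odd because
   [f(1,...,1) = 1]. *)
pose l := [seq i <- enum 'I_n | F (pred1 i)].
have F_count b : F b = odd (count b l).
  have -> : F b = odd (count (fun i => F (pred1 i)) (filter b (enum 'I_n))).
    rewrite -F_seq; apply: eqF => i; rewrite count_uniq_mem ?(filter_uniq _ (enum_uniq _)) //.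
    by rewrite mem_filter mem_enum andbT oddb.
  rewrite /l !count_filter; congr odd; apply: eq_count => i.
  by rewrite /= [in LHS](andbC (F _)).
have odd_l : odd (size l) by rewrite -count_predT -F_count.
have := odd_elt_in_clone odd_l; congr (C _); apply/ffunP => x; rewrite !ffunE.
by congr enc; apply: eq_odd_elt => a; rewrite /odd_count -F_count.
Qed.

End FromZ2.

Theorem theorem7p4 (C : opfam 'I_3) :
  is_clone C -> idempotent_clone C -> malcev C -> ~ has_majority C ->
  ~ clone_preserves C phi ->
  minion_equiv C Z2.
Proof.
move=> C_clone C_idem [d [Cd dM]] noM noP.
pose d3 x y z := d (tri x y z).
have Cd3 : in_tern C d3 by apply: in_tern_app.
have dl x y : d3 y x x = y by case: (dM x y).
have dr x y : d3 x x y = y by case: (dM x y).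
have [xi [dom [q [dom_ex dq]]]] := affine_section C_clone C_idem Cd3 dl dr noM noP.
split=> //.
have [m [Cm mP]] := minority_of_section C_clone Cd3 dl dr dom_ex dq.
have mE : minority3 (fun x y z => dec i0 (m (enc i0 x) (enc i0 y) (enc i0 z))).
  by move=> x y; have [-> -> ->] := mP (enc i0 x) (enc i0 y); rewrite encK.
have [c Cc] := gen_sum_in_clone C_clone C_idem (in_elt_tern i0 Cm) mE noP.
by exists (sum_hom c); apply: sum_hom_minion.
Qed.
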